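(* Let $f=\sum_{i=0}^n a_ix^i\in\mathbb{Z}[x]$ with $n>0$, $a_n>0$, $a_0\neq0$ and $\gcd(a_0,\dots,a_n)=1$. If $f\in\Phi_1$ has at least one positive real root $x_+$, then $x_+$ is the unique positive real root of $f$, $x_+$ is a simple root, and $x_+\geq|z|$ for every (complex) root $z$ of $f$. If moreover $f$ has a root $z\neq x_+$ satisfying $|z|=x_+$, then $z$ is a simple root of $f$ and $z^{\delta}\in\mathbb{R}_{>0}$ for some integer $\delta>1$, or equivalently, the argument of $z$ satisfies $\mathrm{Arg}(z)/\pi\in\mathbb{Q}$.
   Context: For $h\in\mathbb{Z}[x]$, $\mathrm{lt}(h)$ is the leading term and $h^+,h^-\in\mathbb{N}[x]$ are the positive and negative parts, $h=h^+-h^-$ with no monomial occurring in both. $\Phi_0=\{h\in\mathbb{Z}[x]\mid \mathrm{lt}(h)=h^+\}$ and $\Phi_1=\{h\in\mathbb{Z}[x]\mid hg\in\Phi_0\text{ for some monic }g\in\mathbb{Z}[x]\}$. *)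

(* Defs.v *)
From mathcomp Require Export all_boot all_order all_algebra.
From mathcomp Require Export complex.
From mathcomp Require Export reals trigo.
Set Implicit Arguments.
Unset Strict Implicit.
Unset Printing Implicit Defensive.
Export Order.TTheory GRing.Theory Num.Theory.
Local Open Scope ring_scope.

(* Polynomials with coefficients in N are encoded as elements of {poly int}
   with nonnegative coefficients, so that they compare directly with lt(h). *)

Definition leading_term (h : {poly int}) : {poly int} :=
  lead_coef h *: 'X^((size h).-1).

Definition pos_part (h : {poly int}) : {poly int} :=
  \poly_(i < size h) Num.max h`_i 0.

Definition neg_part (h : {poly int}) : {poly int} :=
  \poly_(i < size h) Num.max (- h`_i) 0.

Lemma pos_partE h i : (pos_part h)`_i = Num.max h`_i 0.
Proof.
rewrite coef_poly; case: ltnP => // hi.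
by rewrite nth_default // maxxx.
Qed.

Lemma neg_partE h i : (neg_part h)`_i = Num.max (- h`_i) 0.
Proof.
rewrite coef_poly; case: ltnP => // hi.
by rewrite nth_default // oppr0 maxxx.
Qed.

Lemma pos_neg_partP (h : {poly int}) :
  [/\ h = pos_part h - neg_part h,
      forall i, 0 <= (pos_part h)`_i,
      forall i, 0 <= (neg_part h)`_i
    & forall i, (pos_part h)`_i = 0 \/ (neg_part h)`_i = 0].
Proof.
split=> [|i|i|i]; rewrite ?pos_partE ?neg_partE ?le_max ?lexx ?orbT //.
- apply/polyP=> i; rewrite coefB pos_partE neg_partE.
  case: (lerP 0 h`_i) => hi.
    by rewrite max_r ?oppr_le0 ?subr0.
  by rewrite max_l ?oppr_ge0 1?ltW // sub0r opprK.
- by case: (lerP 0 h`_i) => hi; [right; rewrite max_r ?oppr_le0 | left].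
Qed.

Definition Phi0 (h : {poly int}) : Prop := leading_term h = pos_part h.

Definition Phi1 (h : {poly int}) : Prop :=
  exists2 g : {poly int}, g \is monic & Phi0 (h * g).

Section Arg.
Variable R : realType.
Implicit Type z : complex R.

(* The principal argument, in ]-pi, pi] for z != 0 (see ArgP);
   its value at z = 0 is irrelevant. *)
Definition Arg z : R :=
  if 0 <= complex.Im z then acos (complex.Re z / Normc.normc z)
  else - acos (complex.Re z / Normc.normc z).

Lemma ArgP z : z != 0 ->
  [/\ - pi < Arg z, Arg z <= pi,
      complex.Re z = Normc.normc z * cos (Arg z)
    & complex.Im z = Normc.normc z * sin (Arg z)].
Proof.
case: z => a b z0; rewrite /Arg /=.
have n0 : 0 < a ^+ 2 + b ^+ 2.
  rewrite lt_def addr_ge0 ?sqr_ge0 // andbT paddr_eq0 ?sqr_ge0 // !sqrf_eq0.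
  by apply: contra z0 => /andP[/eqP -> /eqP ->].
set r := Num.sqrt _; have r0 : 0 < r by rewrite sqrtr_gt0.
have rE : r ^+ 2 = a ^+ 2 + b ^+ 2 by rewrite sqr_sqrtr // ltW.
have cb : -1 <= a / r <= 1.
  rewrite -ler_norml normrM normfV (gtr0_norm r0) ler_pdivrMr // mul1r.
  by rewrite -(@ler_pXn2r _ 2) ?nnegrE ?(ltW r0) ?normr_ge0 // real_normK ?num_real // rE lerDl sqr_ge0.
have cE : r * cos (acos (a / r)) = a.
  by rewrite acosK ?in_itv //= mulrC divfK // gt_eqF.
have sE : r * sin (acos (a / r)) = `|b|.
  have -> : `|b| = Num.sqrt (b ^+ 2) by rewrite sqrtr_sqr.
  rewrite sin_acos // -[X in X * _](gtr0_norm r0) -sqrtr_sqr -sqrtrM ?sqr_ge0 //.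
  congr Num.sqrt; rewrite mulrBr mulr1 -exprMn [r * _]mulrC divfK ?gt_eqF //.
  by rewrite rE [a ^+ 2 + _]addrC addrK.
have A0 := acos_ge0 cb; have A1 := acos_lepi cb; have p0 := pi_gt0 R.
case: (lerP 0 b) => hb; split.
- by apply: lt_le_trans A0; rewrite oppr_lt0.
- by [].
- by rewrite cE.
- by rewrite sE ger0_norm.
- rewrite ltrN2 acos_ltpi //; case/andP: cb => c1 ->; rewrite andbT.
  rewrite lt_neqAle c1 andbT; apply/eqP => e.
  move: sE; rewrite -e acosN1 sinpi mulr0 => /esym/eqP.
  by rewrite normr_eq0 lt_eqF.
- by apply: le_trans (ltW p0); rewrite oppr_le0.
- by rewrite cosN cE.
- by rewrite sinN mulrN sE ltr0_norm // opprK.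
Qed.

End Arg.

(* Main.v *)
(** If f g = F with F in Phi_0, then F = c x^m - sum_(i < m) b_i x^i with c > 0
    and all b_i >= 0, so F(x) / x^m is nondecreasing for x > 0, and strictly
    increasing once F has a positive root (some b_i is then nonzero).  This
    gives uniqueness of the positive root x_+, and |z| <= x_+ for every root z,
    because F(|z|) <= 0.  If |z| = x_+, the triangle inequality
    c |z|^m <= sum b_i |z|^i is an equality, which forces
    z^(m-i) = x_+^(m-i) whenever b_i > 0.  Finally
    z F'(z) = z F'(z) - m F(z) = sum (m-i) b_i z^i
            = (z/x_+)^m sum (m-i) b_i x_+^i
    is nonzero, hence z is simple for F, and a fortiori for f. *)
Require Import Defs.
Set Implicit Arguments.
Unset Strict Implicit.
Unset Printing Implicit Defensive.
Local Open Scope ring_scope.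
Local Open Scope complex_scope.

Lemma horner_coef_pred (R : nzRingType) (p : {poly R}) (z : R) :
  p.[z] = \sum_(i < (size p).-1) p`_i * z ^+ i + lead_coef p * z ^+ (size p).-1.
Proof.
by rewrite (@horner_coef_wide _ (size p).-1.+1) ?leqSpred // big_ord_recr.
Qed.

(** With m = [(size p).-1], the left side equals x^m p(z) - z^m p(x), where the leading terms
    cancel. This compares p(z) / z^m with p(x) / x^m without dividing. *)
Lemma horner_sub_root (R : comNzRingType) (p : {poly R}) (x z : R) :
  root p x ->
  x ^+ (size p).-1 * p.[z] =
  \sum_(i < (size p).-1)
    p`_i * (x ^+ (size p).-1 * z ^+ i - z ^+ (size p).-1 * x ^+ i).
Proof.
move=> /rootP px0; set m := (size p).-1.
have e : z ^+ m * p.[x] = 0 by rewrite px0 mulr0.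
rewrite -[LHS]subr0 -[X in _ - X]e !horner_coef_pred -/m.
rewrite !mulrDr !mulr_sumr opprD addrACA [X in _ + X](_ : _ = 0) ?addr0.
  by rewrite -sumrB; apply: eq_bigr => i _; rewrite mulrBr !(mulrCA _ p`_i).
by rewrite ![_ * (lead_coef p * _)]mulrCA (mulrC (z ^+ m)) subrr.
Qed.

(** With m = [(size p).-1], subtracting m p(z) = 0 from z p'(z) removes the leading term. *)
Lemma horner_deriv_root (R : comNzRingType) (p : {poly R}) (z : R) :
  root p z ->
  z * p^`().[z] =
  - \sum_(i < (size p).-1) (p`_i * z ^+ i) *+ ((size p).-1 - i).
Proof.
move=> /rootP pz0; set m := (size p).-1.
have -> : z * p^`().[z] = \sum_(i < m.+1) (p`_i * z ^+ i) *+ i.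
  rewrite (@horner_coef_wide _ m); last first.
    by apply: leq_trans (size_poly _ _) _.
  rewrite big_ord_recl mulr0n add0r mulr_sumr; apply: eq_bigr => i _.
  by rewrite coef_deriv exprS mulrCA mulrnAl.
have e : p.[z] *+ m = 0 by rewrite pz0 mul0rn.
rewrite -[LHS]subr0 -[X in _ - X]e horner_coef_pred -/m.
rewrite big_ord_recr /= mulrnDl opprD addrACA subrr addr0.
rewrite -sumrMnl -sumrB -sumrN; apply: eq_bigr => i _.
by rewrite mulrnBr ?opprB // ltnW.
Qed.

Section NonposTail.
Variables (K : numFieldType) (p : {poly K}).
Hypotheses (p_le0 : forall i, (i < (size p).-1)%N -> p`_i <= 0)
           (lp_gt0 : 0 < lead_coef p).
Variable x : K.
Hypotheses (x_gt0 : 0 < x) (px0 : root p x).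

(** Otherwise p(x) would reduce to its leading term, which is positive. *)
Lemma nonpos_tail_neg_coef : exists i : 'I_(size p).-1, p`_i < 0.
Proof.
have [i pi|p0] := pickP (fun i : 'I_(size p).-1 => p`_i < 0).
  by exists i.
move/rootP: px0; rewrite horner_coef_pred big1 ?add0r => [/eqP|i _].
  by rewrite gt_eqF // mulr_gt0 ?exprn_gt0.
have /negbT := p0 i; rewrite lt_neqAle p_le0 // andbT negbK => /eqP->.
by rewrite mul0r.
Qed.

Lemma nonpos_tail_horner_gt0 y : x < y -> 0 < p.[y].
Proof.
move=> xy; have y_gt0 := lt_trans x_gt0 xy; set m := (size p).-1.
have x0 n : 0 < x ^+ n by rewrite exprn_gt0.
have y0 n : 0 < y ^+ n by rewrite exprn_gt0.
(* The difference is x^i y^i (x^(m-i) - y^(m-i)). *)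
have lt0 i : (i < m)%N -> x ^+ m * y ^+ i - y ^+ m * x ^+ i < 0.
  move=> im; rewrite subr_lt0 -(subnK (ltnW im)) !exprD -!mulrA.
  rewrite (mulrC (y ^+ i)) ltr_pM2r ?mulr_gt0 // ltrXn2r ?(ltW x_gt0) //.
  by rewrite -lt0n subn_gt0.
rewrite -(pmulr_rgt0 _ (x0 m)) horner_sub_root // -/m.
have [j pj] := nonpos_tail_neg_coef.
rewrite (bigD1 j) //=; apply: ltr_pwDl; first by rewrite nmulr_rgt0 ?lt0.
by apply: sumr_ge0 => i _; rewrite mulr_le0 ?p_le0 // ltW ?lt0.
Qed.

Lemma nonpos_tail_norm_root z : root p z -> `|z| <= x.
Proof.
(* The order of [K] may be partial; negating the inequality uses that both sides are real. *)
move=> /rootP pz0; rewrite real_leNgt ?normr_real ?gtr0_real //.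
apply/negP => /nonpos_tail_horner_gt0; apply/negP; rewrite le_gtF //.
move/eqP: pz0; rewrite !horner_coef_pred addrC addr_eq0 => /eqP pz.
rewrite addrC -lerBrDr sub0r -normrX -{1}(gtr0_norm lp_gt0) -normrM pz.
rewrite normrN -sumrN; apply: le_trans (ler_norm_sum _ _ _) _.
by apply: ler_sum => i _; rewrite normrM normrX ler0_norm ?p_le0 // mulNr.
Qed.

(** The last hypothesis is immediate at z = x, and [nonpos_tail_peripheral] supplies it when |z| =
    x, so one lemma serves both simplicity claims. *)
Lemma nonpos_tail_deriv_neq0 z : root p z -> z != 0 ->
    (forall i : 'I_(size p).-1, p`_i < 0 ->
       x ^+ (size p).-1 * z ^+ i = z ^+ (size p).-1 * x ^+ i) ->
  p^`().[z] != 0.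
Proof.
move=> pz0 z0; set m := (size p).-1 => xz.
suff: x ^+ m * (z * p^`().[z]) != 0 by rewrite !mulf_eq0 !negb_or => /and3P[].
rewrite horner_deriv_root // -/m mulrN oppr_eq0 mulr_sumr.
have -> : \sum_(i < m) x ^+ m * (p`_i * z ^+ i *+ (m - i)) =
          z ^+ m * \sum_(i < m) (p`_i * x ^+ i) *+ (m - i).
  rewrite mulr_sumr; apply: eq_bigr => i _; rewrite !mulrnAr !(mulrCA _ p`_i).
  have := p_le0 (ltn_ord i); rewrite le_eqVlt => /predU1P[->|/xz->//].
  by rewrite !mul0r.
rewrite mulf_neq0 ?expf_neq0 //.
have [j pj] := nonpos_tail_neg_coef.
rewrite lt_eqF // (bigD1 j) //= ltr_nwDl //.
  by rewrite pmulrn_llt0 ?subn_gt0 // pmulr_llt0 ?exprn_gt0.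
by apply: sumr_le0 => i _; rewrite mulrn_wle0 // pmulr_lle0 ?exprn_gt0 ?p_le0.
Qed.

End NonposTail.

Lemma nonpos_tail_peripheral (C : numClosedFieldType) (p : {poly C}) (x z : C) :
    (forall i, (i < (size p).-1)%N -> p`_i <= 0) ->
    0 < x -> root p x -> root p z -> `|z| = x ->
  forall i : 'I_(size p).-1, p`_i < 0 ->
    x ^+ (size p).-1 * z ^+ i = z ^+ (size p).-1 * x ^+ i.
Proof.
set m := (size p).-1 => p_le0 x_gt0 px0 pz0 zx i pi_lt0.
have z0 n : z ^+ n != 0 by rewrite expf_neq0 // -normr_gt0 zx.
(* The factor x^m / z^m has modulus 1 and is chosen so that |F j| = G j and the sums of [F] and [G]
   agree; the equality case of the triangle inequality, [normC_sum_upper], then gives F i = G i. *)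
pose F (j : 'I_m) := - p`_j * (x ^+ m * z ^+ j / z ^+ m).
pose G (j : 'I_m) := - p`_j * x ^+ j.
suff /eqP : F i = G i.
  have nz : - p`_i != 0 by rewrite oppr_eq0 lt_eqF.
  rewrite (inj_eq (mulfI nz)) -(inj_eq (mulIf (z0 m))) divfK //.
  by rewrite [X in _ == X]mulrC => /eqP.
apply: (@normC_sum_upper _ _ xpredT) => // [j _|].
  rewrite /F /G !normrM normrN normfV !normrX zx gtr0_norm //.
  rewrite [X in _ * X]mulrAC divff ?expf_neq0 ?gt_eqF // mul1r.
  by rewrite ler0_norm ?p_le0.
have := horner_sub_root z px0; rewrite (rootP pz0) mulr0 -/m => /esym/eqP.
under eq_bigr do rewrite mulrBr.
rewrite sumrB subr_eq0 => /eqP e.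
apply: (mulIf (z0 m)); rewrite !mulr_suml.
under eq_bigr do rewrite /F mulrA divfK // mulNr.
under [RHS]eq_bigr do rewrite /G !mulNr mulrAC -mulrA.
by rewrite !sumrN e.
Qed.

(** At a root z of p, (p g)'(z) = p'(z) g(z), so p'(z) is nonzero, whereas a factor (X - z)^2 of p
    would make it vanish. *)
Lemma mup_factor_simple (K : fieldType) (p g : {poly K}) (z : K) :
  root p z -> (p * g)^`().[z] != 0 -> mup z p = 1%N.
Proof.
move=> pz0; rewrite derivM !hornerE (rootP pz0) mul0r addr0 mulf_eq0 negb_or.
case/andP=> p'z _.
have p0 : p != 0 by apply: contraNneq p'z => ->; rewrite deriv0 horner0.
apply/eqP; rewrite eqn_leq -XsubC_dvd // dvdp_XsubCl pz0 andbT mup_leq //.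
apply: contra p'z => /dvdpP[r ->].
by rewrite expr2 mulrA derivM !(hornerE, subrr, mulr0, mul0r).
Qed.

Lemma Phi0_coef_le0 (h : {poly int}) (i : nat) :
  Phi0 h -> (i < (size h).-1)%N -> h`_i <= 0.
Proof.
move=> /(congr1 (fun q : {poly int} => q`_i)) + im.
rewrite pos_partE coefZ coefXn ltn_eqF // mulr0 => e.
by rewrite [X in _ <= X]e le_max lexx.
Qed.

(** For k the floor of t / pi, t - k pi lies in [0, pi[ and its sine is sin t up to sign, hence
    zero; as sine is positive on ]0, pi[, t = k pi. *)
Lemma sin_eq0_int (R : realType) (t : R) :
  sin t = 0 -> exists k : int, t = k%:~R * pi.
Proof.
move=> t0; have pi0 := pi_gt0 R; exists (Num.floor (t / pi)).
have /andP[] := floor_itv (t / pi); move: (Num.floor _) => k.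
rewrite ler_pdivlMr // ltr_pdivrMr // rmorphD /= mulrDl mul1r => kt tk.
apply/eqP; rewrite eq_le kt andbT -subr_le0 leNgt; apply/negP => s0.
have : 0 < sin (t - k%:~R * pi) by rewrite sin_gt0_pi // s0 ltrBlDl.
suff -> : sin (t - k%:~R * pi) = 0 by rewrite ltxx.
(* [alternatingn] shifts by natural multiples of pi, hence the split on the sign of k. *)
case: k {kt tk s0} => k.
  apply/eqP; suff: (-1) ^+ k * sin (t - k%:~R * pi) == 0.
    by rewrite mulf_eq0 signr_eq0.
  by rewrite -(alternatingn (@sinDpi R)) mulr_natl subrK t0.
rewrite NegzE rmorphN mulNr opprK mulr_natl.
by rewrite (alternatingn (@sinDpi R)) t0 mulr0.
Qed.

(** De Moivre's formula, by induction with the addition formulas. *)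
Lemma expr_Arg (R : realType) (z : R[i]) n : z != 0 ->
  z ^+ n =
  (Normc.normc z ^+ n)%:C * (cos (Arg z *+ n) +i* sin (Arg z *+ n)).
Proof.
move=> /ArgP[_ _ rE iE]; elim: n => [|n IH].
  by rewrite !expr0 mulr0n cos0 sin0 mul1r.
have zE : z = (Normc.normc z)%:C * (cos (Arg z) +i* sin (Arg z)).
  by apply/eqP; rewrite eq_complex /= !mul0r subr0 addr0 -rE -iE !eqxx.
rewrite exprS IH [X in X * _ = _]zE mulrACA -rmorphM -exprS.
rewrite mulrS cosD sinD; congr (_ * _); simpc.
by rewrite [cos _ * sin _ + _]addrC.
Qed.

(** The imaginary part of z^d is |z|^d sin (d Arg z), so d Arg z is an integer multiple of pi. *)
Lemma Arg_rational (R : realType) (z : R[i]) (d : nat) (r : R) :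
  z != 0 -> (0 < d)%N ->
  z ^+ d = r%:C -> exists q : rat, Arg z / pi = ratr q.
Proof.
move=> z0 d0; rewrite expr_Arg // => /(congr1 (fun w : R[i] => complex.Im w)) /=.
rewrite !mul0r addr0 => /eqP; rewrite mulf_eq0 expf_eq0.
have /negPf-> : Normc.normc z != 0.
  by apply: contraNneq z0 => /Normc.eq0_normc->.
rewrite andbF /= => /eqP/sin_eq0_int[k kE].
exists (k%:~R / d%:R); rewrite fmorph_div /= ratr_int ratr_nat.
apply/eqP; rewrite eqr_div ?pnatr_eq0 -?lt0n ?lt0r_neq0 ?pi_gt0 //.
by rewrite mulr_natr kE.
Qed.

Lemma Phi0_map_coef_le0 (K : numDomainType) (h : {poly int}) :
  let p : {poly K} := map_poly intr h in
  Phi0 h -> forall i, (i < (size p).-1)%N -> p`_i <= 0.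
Proof.
move=> p h0 i; rewrite size_map_inj_poly //; last exact: intr_inj.
by rewrite coef_map_id0 // lerz0; apply: Phi0_coef_le0.
Qed.

Theorem corollary4p4 (R : realType) (n : nat) (a : 'I_n.+1 -> int)
    (f : {poly int}) (fE : f = \sum_(i < n.+1) a i *: 'X^i)
    (n_gt0 : (0 < n)%N) (an_gt0 : 0 < a ord_max) (a0_neq0 : a ord0 != 0)
    (gcd_a : \big[gcdz/0]_(i < n.+1) a i = 1)
    (fPhi1 : Phi1 f)
    (xp : R) (xp_gt0 : 0 < xp) (xp_root : root (map_poly intr f) xp) :
  let fC : {poly R[i]} := map_poly intr f in
  [/\ forall y : R, 0 < y -> root (map_poly intr f) y -> y = xp,
      mup xp (map_poly intr f) = 1%N,
      forall z : R[i], root fC z -> `|z| <= xp%:C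
    & forall z : R[i], root fC z -> z != xp%:C -> `|z| = xp%:C ->
      let some_power_positive :=
        exists2 d : nat, (1 < d)%N & exists2 r : R, 0 < r & z ^+ d = r%:C in
      [/\ mup z fC = 1%N,
          some_power_positive
        & some_power_positive <-> exists q : rat, Arg z / pi = ratr q]].
Proof.
move=> fC; case: fPhi1 => g g_monic Phi0_fg.
have lf : lead_coef f = a ord_max.
  have -> : f = \poly_(i < n.+1) a (inord i).
    by rewrite fE poly_def; apply: eq_bigr => i _; rewrite inord_val.
  have nE : ord_max = inord n :> 'I_n.+1 by apply: val_inj; rewrite /= inordK.
  by rewrite lead_coef_poly //= -nE // gt_eqF.
have lfg (K : numDomainType) : 0 < lead_coef (map_poly intr (f * g) : {poly K}).
  rewrite lead_coef_map_inj //; last exact: intr_inj.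
  by rewrite lead_coef_Mmonic // lf ltr0z.
have fgE (K : numFieldType) :
    map_poly intr (f * g) = map_poly intr f * map_poly intr g :> {poly K}.
  exact: rmorphM.
have fg_root (K : numFieldType) (z : K) :
    root (map_poly intr f) z -> root (map_poly intr (f * g)) z.
  by rewrite fgE rootM => ->.
have le0 (K : numFieldType) := @Phi0_map_coef_le0 K _ Phi0_fg.
have xpC_gt0 : 0 < xp%:C by rewrite ltcR.
have xpC_root : root fC xp%:C.
  have -> : fC = map_poly (real_complex R) (map_poly intr f).
    by rewrite -map_poly_comp; apply: eq_map_poly => k /=; rewrite rmorph_int.
  by rewrite fmorph_root.
split.
- move=> y y_gt0 fy.
  (* The product f g is positive beyond its root u, so no root v > u exists; totality of the order
     then covers both cases. *)
  have le_root_eq u v : 0 < u -> root (map_poly intr f) u ->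
      root (map_poly intr f) v -> u <= v -> v = u :> R.
    move=> u0 /fg_root fu /fg_root/rootP fv.
    rewrite le_eqVlt => /predU1P[->//|uv].
    by have := nonpos_tail_horner_gt0 (le0 _) (lfg _) u0 fu uv; rewrite fv ltxx.
  by case/orP: (le_total xp y) => xy; [|symmetry]; apply: le_root_eq xy.
- apply: (@mup_factor_simple _ _ (map_poly intr g)) => //; rewrite -fgE.
  have xr := fg_root _ _ xp_root.
  by apply: (nonpos_tail_deriv_neq0 (le0 _) (lfg _) xp_gt0); rewrite ?gt_eqF.
- move=> z fz; apply: (nonpos_tail_norm_root (le0 _) (lfg _)) => //;
  exact: fg_root.
move=> z fz zNx zx pos.
have z0 : z != 0 by rewrite -normr_gt0 zx.
have [xr zr] := (fg_root _ _ xpC_root, fg_root _ _ fz).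
have per := nonpos_tail_peripheral (le0 _) xpC_gt0 xr zr zx.
have pos_true : pos.
  have [i pi_lt0] := nonpos_tail_neg_coef (le0 _) (lfg _) xpC_gt0 xr.
  have := per i pi_lt0; move: (ltn_ord i); set m := (size _).-1 => im.
  have expm w : w ^+ m = w ^+ (m - i) * w ^+ i by rewrite -exprD subnK // ltnW.
  rewrite !expm -!mulrA (mulrC (z ^+ i)) => e.
  (* Cancelling x_+^i z^i leaves the exponent d = m - i. *)
  have {}e : z ^+ (m - i) = xp%:C ^+ (m - i).
    by apply/esym; apply: (mulIf _ e); rewrite mulf_neq0 ?expf_neq0 // gt_eqF.
  exists (m - i)%N; last first.
    by exists (xp ^+ (m - i)); rewrite ?exprn_gt0 // e rmorphXn.
  (* Here d = 1 would give z = x_+, which is excluded. *)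
  rewrite ltn_neqAle subn_gt0 im andbT; apply: contra zNx => /eqP d1.
  by rewrite -d1 !expr1 in e; apply/eqP.
split=> //.
  apply: (@mup_factor_simple _ _ (map_poly intr g)) => //; rewrite -fgE.
  exact: (nonpos_tail_deriv_neq0 (le0 _) (lfg _) xpC_gt0).
(* [pos_true] settles one implication; the other is [Arg_rational]. *)
split=> // -[d d_gt1 [r _ zd]]; apply: Arg_rational zd => //.
exact: ltnW.
Qed.
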